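(* Let $d_x,d_r\ge 1$ be integers, let $\mathbf{A}\in\mathbb{R}^{d_r\times d_r}$, $\mathbf{W}^{in}\in\mathbb{R}^{d_r\times d_x}$ and $\mathbf{W}^{out}_1,\mathbf{W}^{out}_2\in\mathbb{R}^{d_x\times d_r}$ be matrices, and let $\mathbf{x}_1,\mathbf{x}_2,\ldots\in\mathbb{R}^{d_x}$ be a sequence of vectors. Consider the reservoir computer with identity activation function and Hadamard quadratic read-out: $\mathbf{r}_1=0\in\mathbb{R}^{d_r}$ and, for $i\ge 1$, $$\mathbf{r}_{i+1}=\mathbf{A}\mathbf{r}_i+\mathbf{W}^{in}\mathbf{x}_i,\qquad \mathbf{y}_{i+1}=\mathbf{W}^{out}_1\mathbf{r}_{i+1}+\mathbf{W}^{out}_2(\mathbf{r}_{i+1}\circ\mathbf{r}_{i+1}).$$ Then the output is a quadratic nonlinear vector autoregression in the inputs: for every $\ell\ge 1$, $$\mathbf{y}_{\ell+1}=\sum_{j=1}^{\ell}a_j\,\mathbf{x}_{\ell+1-j}+\sum_{i,j=1}^{\ell}a_{2,(i,j)}\,p_2(\mathbf{x}_{\ell+1-i},\mathbf{x}_{\ell+1-j}),$$ where the $\ell$ linear coefficient matrices, of size $d_x\times d_x$, are $$a_j=\mathbf{W}^{out}_1\mathbf{A}^{j-1}\mathbf{W}^{in},\qquad j=1,\ldots,\ell,$$ and the $\ell^2$ quadratic coefficient matrices, of size $d_x\times d_x^2$, are $$a_{2,(i,j)}=\mathbf{W}^{out}_2\,P_2(\mathbf{A}^{i-1}\mathbf{W}^{in},\mathbf{A}^{j-1}\mathbf{W}^{in}),\qquad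 i,j=1,\ldots,\ell.$$
   Context: Conventions: $\mathbf{A}^0=I$ is the identity matrix. The symbol $\circ$ denotes the Hadamard (componentwise) product of vectors of equal length, $[\mathbf{v}\circ\mathbf{w}]_j=v_jw_j$. For $\mathbf{v},\mathbf{w}\in\mathbb{R}^n$, $p_2(\mathbf{v},\mathbf{w})\in\mathbb{R}^{n^2}$ is the vector of all products $$p_2(\mathbf{v},\mathbf{w})=[v_1w_1\,|\,v_1w_2\,|\cdots|\,v_1w_n\,|\,v_2w_1\,|\,v_2w_2\,|\cdots|\,v_nw_n]^T.$$ For $B=[\mathbf{b}_1|\cdots|\mathbf{b}_n]$ and $C=[\mathbf{c}_1|\cdots|\mathbf{c}_n]$ in $\mathbb{R}^{m\times n}$, written by columns, $P_2(B,C)\in\mathbb{R}^{m\times n^2}$ is the matrix whose columns are the Hadamard products of columns, in the same order: $$P_2(B,C)=[\mathbf{b}_1\circ\mathbf{c}_1\,|\,\mathbf{b}_1\circ\mathbf{c}_2\,|\cdots|\,\mathbf{b}_1\circ\mathbf{c}_n\,|\,\mathbf{b}_2\circ\mathbf{c}_1\,|\cdots|\,\mathbf{b}_n\circ\mathbf{c}_n].$$ The read-out is the linear map $\mathbf{W}^{out}=[\mathbf{W}^{out}_1\,|\,\mathbf{W}^{out}_2]\in\mathbb{R}^{d_x\times 2d_r}$ applied to the stacked vector consisting of $\mathbf{r}$ followed by $\mathbf{r}\circ\mathbf{r}$. *)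

(* Defs.v *)
(* The field of real numbers is an arbitrary [R : realType]. *)
From mathcomp Require Import all_boot all_order all_algebra.
From mathcomp Require Import reals.

Set Implicit Arguments.
Unset Strict Implicit.
Unset Printing Implicit Defensive.

Import GRing.Theory.
Local Open Scope ring_scope.

Definition hadamard (R : realType) (n : nat) (v w : 'cV[R]_n) : 'cV[R]_n :=
  \col_j (v j 0 * w j 0).

(* The products indexed by (i, j) are listed in the order
   (0,0), (0,1), ..., (0,n-1), (1,0), ..., (n-1,n-1),
   so that position k holds the pair (k %/ n, k %% n). *)
Lemma pair_fst_subproof (n : nat) (k : 'I_(n * n)) : (k %/ n < n)%N.
Proof. by case: n k => [[]//|n] k; rewrite ltn_divLR. Qed.

Lemma pair_snd_subproof (n : nat) (k : 'I_(n * n)) : (k %% n < n)%N.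
Proof. by case: n k => [[]//|n] k; rewrite ltn_pmod. Qed.

Definition pair_fst (n : nat) (k : 'I_(n * n)) : 'I_n :=
  Ordinal (pair_fst_subproof k).

Definition pair_snd (n : nat) (k : 'I_(n * n)) : 'I_n :=
  Ordinal (pair_snd_subproof k).

Definition p2 (R : realType) (n : nat) (v w : 'cV[R]_n) : 'cV[R]_(n * n) :=
  \col_k (v (pair_fst k) 0 * w (pair_snd k) 0).

Definition P2 (R : realType) (m n : nat) (B C : 'M[R]_(m, n)) :
    'M[R]_(m, n * n) :=
  \matrix_(i, k) hadamard (col (pair_fst k) B) (col (pair_snd k) C) i 0.

(* Main.v *)
(* The state r_(l+1) is the sum of the A^(j-1) Win x_(l+1-j).  The Hadamard
   product is bilinear, so its square expands into a double sum whose terms are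
   split by the mixed-product rule P2(B, C) p2(v, w) = (B v) o (C w). *)
Require Import Defs.
From mathcomp Require Import all_boot all_order all_algebra.
From mathcomp Require Import reals.

Import GRing.Theory.
Local Open Scope ring_scope.

(** Euclidean division by [n] recovers [k] from its quotient and remainder, and both sides have
    [n * n] elements. This turns a sum over positions into a double sum. *)
Lemma pair_fst_snd_bij n :
  bijective (fun k : 'I_(n * n) => (pair_fst k, pair_snd k)).
Proof.
apply: inj_card_bij; last by rewrite card_prod !card_ord.
move=> k k' [Ef Es]; apply: val_inj => /=.
by rewrite (divn_eq k n) (divn_eq k' n) Ef Es.
Qed.

(** In each row the product of two sums is a sum over pairs of columns; reading the pairs as
    positions [k], only a swap of the two middle factors remains. *)
Lemma mul_P2_p2 (R : realType) (m n : nat) (B C : 'M[R]_(m, n))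
    (v w : 'cV[R]_n) :
  P2 B C *m p2 v w = hadamard (B *m v) (C *m w).
Proof.
apply/colP => i; rewrite !mxE big_distrlr pair_bigA /=.
rewrite (reindex _ (onW_bij _ (pair_fst_snd_bij n))) /=.
by apply: eq_bigr => k _; rewrite !mxE mulrACA.
Qed.

Lemma hadamard_sum (R : realType) (n : nat) (I J : Type) (s : seq I)
    (t : seq J) (F : I -> 'cV[R]_n) (G : J -> 'cV[R]_n) :
  hadamard (\sum_(i <- s) F i) (\sum_(j <- t) G j) =
  \sum_(i <- s) \sum_(j <- t) hadamard (F i) (G j).
Proof.
apply/colP => k; rewrite mxE !summxE big_distrlr /=.
apply: eq_bigr => i _; rewrite summxE.
by apply: eq_bigr => j _; rewrite mxE.
Qed.

Lemma linear_reservoir_state (R : realType) (dx dr : nat) (A : 'M[R]_dr)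
    (Win : 'M[R]_(dr, dx)) (x : nat -> 'cV[R]_dx) (r : nat -> 'cV[R]_dr) :
  r 1%N = 0 ->
  (forall i : nat, (1 <= i)%N -> r i.+1 = A *m r i + Win *m x i) ->
  forall l : nat,
    r l.+1 = \sum_(1 <= j < l.+1) A ^+ (j - 1) *m Win *m x (l + 1 - j)%N.
Proof.
move=> r1 rS; elim=> [|l IHl]; first by rewrite r1 big_geq.
(* The term [j = 1] carries the power [A ^+ 0] and is exactly the newest input [Win *m x l.+1]. *)
rewrite rS // IHl [RHS]big_ltn // subnn expr0 mul1mx addnK addrC; congr (_ + _).
(* The older inputs each gain one factor [A]. The range excludes [j = 0], where truncated [j - 1]
   would break the exponent count. *)
rewrite [RHS]big_add1 /= mulmx_sumr; apply: eq_big_nat => -[|j] // _.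
by rewrite !subn1 /= exprS -mulmxE !mulmxA addSn subSS.
Qed.

Theorem mainTheorem2 (R : realType) (dx dr : nat)
    (hdx : (1 <= dx)%N) (hdr : (1 <= dr)%N)
    (A : 'M[R]_dr) (Win : 'M[R]_(dr, dx)) (Wout1 Wout2 : 'M[R]_(dx, dr))
    (x : nat -> 'cV[R]_dx) (r : nat -> 'cV[R]_dr) (y : nat -> 'cV[R]_dx)
    (hr1 : r 1%N = 0)
    (hr : forall i : nat, (1 <= i)%N -> r i.+1 = A *m r i + Win *m x i)
    (hy : forall i : nat, (1 <= i)%N ->
       y i.+1 = Wout1 *m r i.+1 + Wout2 *m hadamard (r i.+1) (r i.+1)) :
  let a (j : nat) : 'M[R]_dx := Wout1 *m (A ^+ (j - 1)) *m Win in
  let a2 (i j : nat) : 'M[R]_(dx, dx * dx) :=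
    Wout2 *m P2 (A ^+ (i - 1) *m Win) (A ^+ (j - 1) *m Win) in
  forall l : nat, (1 <= l)%N ->
    y l.+1 =
      \sum_(1 <= j < l.+1) a j *m x (l + 1 - j)%N
      + \sum_(1 <= i < l.+1) \sum_(1 <= j < l.+1)
          a2 i j *m p2 (x (l + 1 - i)%N) (x (l + 1 - j)%N).
Proof.
move=> a a2 l l_gt0; rewrite hy // (linear_reservoir_state _ _ _ _ _ _ _ hr1 hr).
rewrite hadamard_sum !mulmx_sumr; congr (_ + _).
  by apply: eq_bigr => j _; rewrite /a !mulmxA.
apply: eq_bigr => i _; rewrite mulmx_sumr; apply: eq_bigr => j _.
(* Reassociating isolates the factor [P2 _ _ *m p2 _ _], to which the mixed-product rule applies. *)
by rewrite /a2 -[RHS]mulmxA mul_P2_p2.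
Qed.
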